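(* Let $L>0$. Then for any sufficiently smooth function $u:[0,L]\to\mathbb R$ satisfying $u'(0)=u'(L)=0$ and $$\int_0^L u(s)\,ds=0$$ one has $$\int_0^L u(s)^4\,ds\ \le\ C_0\cdot L\left(\int_0^L u(s)^2\,ds\right)\left(\int_0^L (u'(s))^2\,ds\right)$$ with $C_0=0.162278$.
   Context: All objects are standard. *)

(* Defs.v *)
From Stdlib Require Import Reals.
From Coquelicot Require Import Coquelicot.

Open Scope R_scope.

(** Derivative of [f] relative to [[a, b]]: this is [is_derive] with the
    neighbourhood filter of [x] restricted to [[a, b]], so it is the one-sided
    derivative at [a] and [b], and the values of [f] outside [[a, b]] are
    irrelevant. *)
Definition is_derive_on (a b : R) (f : R -> R) (x l : R) : Prop :=
  filterdiff f (within (fun y => a <= y <= b) (locally x))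
    (fun h => scal h l).

(** [f] is continuously differentiable on [[a, b]] with derivative [f']. *)
Definition is_C1_on (a b : R) (f f' : R -> R) : Prop :=
  (forall x, a <= x <= b -> is_derive_on a b f x (f' x)) /\
  continuous_on (fun x => a <= x <= b) f'.

(* Main.v *)
Require Import Defs.
From Stdlib Require Import Reals Lra Lia ZArith List.
From Coquelicot Require Import Coquelicot.
Import ListNotations.

Open Scope R_scope.

(* Write [C] for the constant, [A] and [B] for the integrals of [u ^ 2] and
   [u' ^ 2].  For [theta >= 0] and a quartic [P] without cubic term,
   [P(t) = - t ^ 4 + lam t ^ 2 + mu t + e], nonnegative on the range [[m, M]]
   of [u], one has [theta u' ^ 2 + P(u) >= 2 sqrt theta |u'| sqrt (P(u))].
   Integrating, and using that [u] has mean zero,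
     [theta B - int u ^ 4 + lam A + e L >= 2 sqrt theta int_m^M sqrt P].
   With [theta = C L A] the theorem follows as soon as
   [lam A + e L <= 2 sqrt (C L A) int_m^M sqrt P] for some such [P].

   Normalise the range to [[tau - 1, tau + 1]].  It is enough to use the
   quartics [P(t) = (1 - (t - tau) ^ 2) ((t + tau) ^ 2 + d ^ 2)], which vanish
   at the ends of the range, with one free parameter [d]: the extremal of the
   inequality has [tau = 0] and satisfies [theta u' ^ 2 = P(u)].  The elliptic
   integral of [sqrt P] is bounded below by Cauchy's inequality in [d] and
   truncated binomial series, integrated exactly against the semicircle
   weight; what remains is a two-parameter inequality in [tau] and [A / L],
   certified with integer arithmetic.  When [A / L] is too small the cruder
   [P(t) = k ^ 2 t ^ 2] suffices. *)

(** * Truncated binomial series of the inverse square root *)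

(** Central binomial coefficient over [4 ^ k]: the coefficient of [v ^ k] in the expansion of
    [1 / sqrt (1 - v)]. *)
Fixpoint binom_half (k : nat) : R :=
  match k with
  | O => 1
  | S k => binom_half k * ((2 * INR k + 1) / (2 * INR k + 2))
  end.

Definition isqrt_series (n : nat) (v : R) : R :=
  sum_f_R0 (fun k => binom_half k * v ^ k) n.

Lemma binom_half_pos k : 0 < binom_half k.
Proof.
induction k as [|k IH]; simpl; [lra|].
pose proof (pos_INR k).
apply Rmult_lt_0_compat; [assumption|].
apply Rdiv_lt_0_compat; lra.
Qed.

(** The full series solves [(1 - v) f' = f / 2]; after truncation the lower coefficients still
    cancel and one term of degree [n] remains. *)
Lemma isqrt_series_derive n v :
  exists D, is_derive (isqrt_series n) v D /\
    (1 - v) * D = isqrt_series n v / 2 - (INR n + / 2) * binom_half n * v ^ n.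
Proof.
induction n as [|n [D [HD E]]].
- exists 0; split.
  + apply (is_derive_ext (fun _ => 1)).
    * intros t; unfold isqrt_series; simpl; ring.
    * apply @is_derive_const.
  + unfold isqrt_series; simpl; field.
- exists (D + binom_half (S n) * (INR (S n) * v ^ n)); split.
  + apply (is_derive_ext
      (fun t => plus (isqrt_series n t) (binom_half (S n) * t ^ S n))).
    * intros t; reflexivity.
    * apply @is_derive_plus; [exact HD|].
      apply is_derive_scal.
      replace (INR (S n) * v ^ n) with (INR (S n) * 1 * v ^ pred (S n))
        by (simpl pred; ring).
      apply is_derive_pow, @is_derive_id.
  + rewrite Rmult_plus_distr_l, E.
    unfold isqrt_series; rewrite tech5; fold (isqrt_series n v).
    pose proof (pos_INR n).
    simpl binom_half; rewrite S_INR; simpl pow; field; lra.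
Qed.

(* The derivative of [isqrt_series n v * sqrt (1 - v)] is a negative multiple
   of [v ^ n / sqrt (1 - v)], so for odd [n] the product is maximal at
   [v = 0]. *)
Lemma isqrt_series_le m v :
  v < 1 -> isqrt_series (S (2 * m)) v * sqrt (1 - v) <= 1.
Proof.
intros Hv.
set (n := S (2 * m)).
set (f := fun t => isqrt_series n t * sqrt (1 - t)).
set (df := fun t => - ((INR n + / 2) * binom_half n * t ^ n / sqrt (1 - t))).
assert (Hd : forall t, t < 1 -> is_derive f t (df t)).
{ intros t Ht.
  destruct (isqrt_series_derive n t) as [D [HD E]].
  assert (Hs : 0 < sqrt (1 - t)) by (apply sqrt_lt_R0; lra).
  assert (Hss : sqrt (1 - t) * sqrt (1 - t) = 1 - t) by (apply sqrt_sqrt; lra).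
  replace (df t)
    with (D * sqrt (1 - t) + isqrt_series n t * (-1 / (2 * sqrt (1 - t)))).
  - apply (is_derive_mult (isqrt_series n) (fun t => sqrt (1 - t))).
    + exact HD.
    + apply is_derive_sqrt; [auto_derive; [easy|ring]|lra].
    + intros; apply Rmult_comm.
  - unfold df.
    replace (D * sqrt (1 - t)) with ((1 - t) * D / sqrt (1 - t))
      by (rewrite <- Hss at 1; field; lra).
    rewrite E; field; lra. }
destruct (MVT_gen f 0 v df) as [c [Hc E]].
- intros t Ht; apply Hd.
  apply Rlt_trans with (Rmax 0 v); [apply Ht|apply Rmax_lub_lt; lra].
- intros t Ht; apply derivable_continuous_pt; exists (df t).
  apply is_derive_Reals, Hd.
  apply Rle_lt_trans with (Rmax 0 v); [apply Ht|apply Rmax_lub_lt; lra].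
- assert (Hc1 : c < 1).
  { apply Rle_lt_trans with (Rmax 0 v); [apply Hc|apply Rmax_lub_lt; lra]. }
  (* The mean value point [c] lies between 0 and [v]; as [n] is odd, [c ^ n * v] is [c * v] times a
     square. *)
  assert (Hcv : 0 <= c * v).
  { destruct (Rle_dec 0 v).
    - rewrite Rmin_left, Rmax_right in Hc by lra; nra.
    - rewrite Rmin_right, Rmax_left in Hc by lra; nra. }
  assert (H0 : f 0 = 1).
  { unfold f; rewrite Rminus_0_r, sqrt_1, Rmult_1_r.
    unfold isqrt_series; clear; induction n as [|n IH]; [simpl; ring|].
    rewrite tech5, IH, pow_i by lia; ring. }
  change (f v <= 1).
  enough (df c * (v - 0) <= 0) by lra.
  unfold df, Rdiv.
  replace (c ^ n) with (c * (c ^ m) ^ 2)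
    by (rewrite <- pow_mult; unfold n; simpl; f_equal; f_equal; lia).
  replace (- _ * (v - 0)) with
    (- ((INR n + / 2) * binom_half n * (c ^ m) ^ 2 * (c * v) * / sqrt (1 - c)))
    by ring.
  assert (0 < / sqrt (1 - c)) by (apply Rinv_0_lt_compat, sqrt_lt_R0; lra).
  pose proof (pos_INR n); pose proof (binom_half_pos n).
  pose proof (pow2_ge_0 (c ^ m)).
  enough (0 <= (INR n + / 2) * binom_half n * (c ^ m) ^ 2 * (c * v)
    * / sqrt (1 - c)) by lra.
  apply Rmult_le_pos; [|lra].
  apply Rmult_le_pos; [|lra].
  apply Rmult_le_pos; [|lra].
  apply Rmult_le_pos; lra.
Qed.

(** * Integer polynomials *)

Fixpoint peval (l : list Z) (x : R) : R :=
  match l with [] => 0 | c :: l => IZR c + x * peval l x end.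

Fixpoint padd (p q : list Z) : list Z :=
  match p, q with
  | [], _ => q
  | _, [] => p
  | a :: p, b :: q => (a + b)%Z :: padd p q
  end.

Definition pscale (c : Z) (p : list Z) : list Z := map (Z.mul c) p.

Definition plin (a b : Z) (p : list Z) : list Z :=
  padd (pscale a p) (0%Z :: pscale b p).

Lemma peval_add p q x : peval (padd p q) x = peval p x + peval q x.
Proof.
revert q; induction p as [|a p IH]; intros [|b q]; simpl; try ring.
rewrite IH, plus_IZR; ring.
Qed.

Lemma peval_scale c p x : peval (pscale c p) x = IZR c * peval p x.
Proof.
induction p as [|a p IH]; simpl; [ring|].
fold (pscale c p); rewrite IH, mult_IZR; ring.
Qed.

Lemma peval_lin a b p x :
  peval (plin a b p) x = (IZR a + IZR b * x) * peval p x.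
Proof. unfold plin; rewrite peval_add; simpl; rewrite !peval_scale; ring. Qed.

Lemma peval_nonneg p x :
  forallb (Z.leb 0) p = true -> 0 <= x -> 0 <= peval p x.
Proof.
intros Hp Hx; induction p as [|a p IH]; simpl in *; [lra|].
apply andb_prop in Hp; destruct Hp as [Ha Hp].
apply Z.leb_le, IZR_le in Ha.
specialize (IH Hp); nra.
Qed.

(* [phomog A B E p] is the pair of [(E (1 + t)) ^ length p] times
   [p ((A + B t) / (E (1 + t)))] and [(E (1 + t)) ^ length p]. *)
Fixpoint phomog (A B E : Z) (p : list Z) : list Z * list Z :=
  match p with
  | [] => ([], [1%Z])
  | c :: p =>
      let (r, w) := phomog A B E p in
      let w' := plin E E w in
      (padd (pscale c w') (plin A B r), w')
  end.

(** A sufficient test only: the substitution carries the interval to the half-line [t >= 0], where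
    nonnegative coefficients settle the sign. *)
Definition pnonneg (A B E : Z) (p : list Z) : bool :=
  forallb (Z.leb 0) (fst (phomog A B E p)).

Lemma phomog_correct A B E p t :
  0 < IZR E -> 0 <= t ->
  let x := (IZR A + IZR B * t) / (IZR E * (1 + t)) in
  0 < peval (snd (phomog A B E p)) t /\
  peval (fst (phomog A B E p)) t = peval (snd (phomog A B E p)) t * peval p x.
Proof.
intros HE Ht x.
induction p as [|c p IH]; simpl; [split; ring_simplify; lra|].
destruct (phomog A B E p) as [r w]; simpl in *.
destruct IH as [IH1 IH2].
rewrite peval_add, peval_scale, !peval_lin, IH2.
split.
- apply Rmult_lt_0_compat; nra.
- unfold x; field; split; nra.
Qed.

(* [x = (A + B t) / (E (1 + t))] with [t >= 0] parametrises [[A/E, B/E)]. *)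
Lemma pnonneg_correct A B E p x :
  (0 < E)%Z -> pnonneg A B E p = true ->
  IZR A <= IZR E * x < IZR B -> 0 <= peval p x.
Proof.
intros HE Hp Hx; apply IZR_lt in HE.
set (t := (IZR E * x - IZR A) / (IZR B - IZR E * x)).
assert (Ht : 0 <= t).
{ apply Rmult_le_pos; [lra|].
  apply Rlt_le, Rinv_0_lt_compat; lra. }
destruct (phomog_correct A B E p t HE Ht) as [Hw Hr].
apply (peval_nonneg _ t) in Hp; [|exact Ht].
rewrite Hr in Hp.
replace ((IZR A + IZR B * t) / (IZR E * (1 + t))) with x in Hp.
- apply (Rmult_le_reg_l (peval (snd (phomog A B E p)) t)); lra.
- unfold t; field; lra.
Qed.

Record series_state := SeriesState
  { ser_num : list Z; ser_pow : list Z; ser_coef : Z; ser_den : Z }.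

(* [ser_num / ser_den] is [isqrt_series n] at [(P - Q z) / D]; the powers
   [(P - Q z) ^ n] and the odd double factorials are carried along. *)
Fixpoint series_poly (P Q D : Z) (n : nat) : series_state :=
  match n with
  | O => SeriesState [1%Z] [1%Z] 1 1
  | S n =>
      let s := series_poly P Q D n in
      let k := (2 * Z.of_nat n)%Z in
      let f := ((k + 1) * ser_coef s)%Z in
      let w := plin P (- Q) (ser_pow s) in
      SeriesState
        (padd (pscale ((k + 2) * D) (ser_num s)) (pscale f w)) w f
        ((k + 2) * D * ser_den s)
  end.

(** Fractions are never reduced; the third invariant puts each new term over the common
    denominator. *)
Lemma series_poly_correct P Q D n z :
  (0 < D)%Z ->
  let s := series_poly P Q D n in
  (0 < ser_den s)%Z /\
  peval (ser_pow s) z = (IZR P - IZR Q * z) ^ n /\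
  IZR (ser_coef s) * IZR D ^ n = IZR (ser_den s) * binom_half n /\
  peval (ser_num s) z
  = IZR (ser_den s) * isqrt_series n ((IZR P - IZR Q * z) / IZR D).
Proof.
intros HD; induction n as [|n [IH0 [IH1 [IH2 IH3]]]]; cbn zeta in *.
- split; [reflexivity|].
  unfold isqrt_series; simpl; repeat split; ring.
- cbn [series_poly ser_den ser_pow ser_coef ser_num].
  set (s := series_poly P Q D n) in *.
  assert (HDR : 0 < IZR D) by (apply IZR_lt; exact HD).
  pose proof (pos_INR n).
  rewrite peval_add, !peval_scale, !peval_lin, IH1, IH3.
  rewrite !mult_IZR, !plus_IZR, mult_IZR, <- INR_IZR_INZ, opp_IZR.
  assert (E : (2 * INR n + 1) * IZR (ser_coef s) * (IZR D * IZR D ^ n)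
    = (2 * INR n + 2) * IZR D * IZR (ser_den s)
      * (binom_half n * ((2 * INR n + 1) / (2 * INR n + 2)))).
  { replace ((2 * INR n + 1) * IZR (ser_coef s) * (IZR D * IZR D ^ n)) with
      ((2 * INR n + 1) * IZR D * (IZR (ser_coef s) * IZR D ^ n)) by ring.
    rewrite IH2; field; lra. }
  repeat split.
  + apply Z.mul_pos_pos; [|exact IH0]; apply Z.mul_pos_pos; lia.
  + simpl; ring.
  + simpl; exact E.
  + unfold isqrt_series; rewrite tech5; fold (isqrt_series n).
    simpl binom_half; simpl pow.
    rewrite Rmult_plus_distr_l.
    set (y := IZR P - IZR Q * z).
    replace (IZR P + - IZR Q * z) with y by (unfold y; ring).
    f_equal; [unfold isqrt_series; ring|].
    match goal with |- _ = ?a * (?c * ?x) => transitivity (a * c * x); [|ring] end.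
    rewrite <- E.
    unfold Rdiv; rewrite Rpow_mult_distr, pow_inv; simpl.
    field; split; [apply pow_nonzero|]; lra.
Qed.

(** * Moments of the semicircle weight *)

(* Coquelicot states equations of integrals in the carrier of a normed module,
   where [ring] does not see [R]. *)
Ltac real_eq := match goal with |- ?a = ?b => change (@eq R a b) end.

Lemma ex_RInt_cont (f : R -> R) a b :
  (forall x, continuous f x) -> ex_RInt f a b.
Proof.
intros Hf; apply (ex_RInt_continuous (V := R_CompleteNormedModule)); auto.
Qed.

Lemma RInt_lin (f g : R -> R) a b x y :
  (forall x, continuous f x) -> (forall x, continuous g x) ->
  RInt (fun x => a * f x + b * g x) x y = a * RInt f x y + b * RInt g x y.
Proof.
intros Hf Hg; apply is_RInt_unique.
apply @is_RInt_plus; apply @is_RInt_scal;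
  now apply (RInt_correct (V := R_CompleteNormedModule)), ex_RInt_cont.
Qed.

Lemma RInt_antiderivative (F f : R -> R) a b :
  (forall x, is_derive F x (f x)) -> (forall x, continuous f x) ->
  RInt f a b = F b - F a.
Proof.
intros HF Hf; apply is_RInt_unique.
apply (is_RInt_derive F f); intros; [apply HF|apply Hf].
Qed.

(* Integral of [f] against the semicircle weight [sqrt (1 - x ^ 2)] on
   [[-1, 1]], with [x = sin p]. *)
Definition semicircle_int (f : R -> R) : R :=
  RInt (fun p => cos p ^ 2 * f (sin p)) (- (PI / 2)) (PI / 2).

Lemma continuous_semicircle (f : R -> R) p :
  (forall x, continuous f x) -> continuous (fun p => cos p ^ 2 * f (sin p)) p.
Proof.
intros Hf.
apply (continuous_mult (fun p => cos p ^ 2) (fun p => f (sin p))).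
- apply (ex_derive_continuous (fun p => cos p ^ 2)); auto_derive; easy.
- apply (continuous_comp sin f); [apply continuous_sin|apply Hf].
Qed.

Lemma ex_RInt_semicircle (f : R -> R) :
  (forall x, continuous f x) ->
  ex_RInt (fun p => cos p ^ 2 * f (sin p)) (- (PI / 2)) (PI / 2).
Proof. intros Hf; apply ex_RInt_cont; intros; now apply continuous_semicircle. Qed.

Lemma semicircle_int_ext f g :
  (forall x, f x = g x) -> semicircle_int f = semicircle_int g.
Proof. intros H; apply RInt_ext; intros; now rewrite H. Qed.

Lemma semicircle_int_le (f g : R -> R) :
  (forall x, continuous f x) -> (forall x, continuous g x) ->
  (forall x, f x <= g x) -> semicircle_int f <= semicircle_int g.
Proof.
intros Hf Hg H; apply RInt_le.
- pose proof PI_RGT_0; lra.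
- now apply ex_RInt_semicircle.
- now apply ex_RInt_semicircle.
- intros p _; apply Rmult_le_compat_l; [apply pow2_ge_0|apply H].
Qed.

Lemma semicircle_int_lin (f g : R -> R) a b :
  (forall x, continuous f x) -> (forall x, continuous g x) ->
  semicircle_int (fun x => a * f x + b * g x)
  = a * semicircle_int f + b * semicircle_int g.
Proof.
intros Hf Hg; unfold semicircle_int.
rewrite <- RInt_lin by (intros; now apply continuous_semicircle).
apply RInt_ext; intros; real_eq; ring.
Qed.

(** Used with [S = 4 tau], so that [2 x + S] is twice [x + 2 tau] and even moments are polynomials
    in [S ^ 2 = 16 tau ^ 2]. *)
Definition moment (S : R) (k : nat) : R :=
  semicircle_int (fun x => (2 * x + S) ^ k).

Lemma continuous_lin_pow S k x : continuous (fun x => (2 * x + S) ^ k) x.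
Proof.
apply (ex_derive_continuous (fun x => (2 * x + S) ^ k)); auto_derive; easy.
Qed.

Lemma moment_0 S : moment S 0 = PI / 2.
Proof.
unfold moment, semicircle_int.
rewrite (RInt_antiderivative (fun p => (p + sin p * cos p) / 2)).
- rewrite cos_neg, cos_PI2; field.
- intros p; auto_derive; [easy|].
  pose proof (sin2_cos2 p); unfold Rsqr in *; simpl; nra.
- intros p; apply (continuous_semicircle (fun x => (2 * x + S) ^ 0)).
  intros; apply continuous_lin_pow.
Qed.

(* Integration of the derivative of [cos p ^ 3 * (2 sin p + S) ^ (k + 1)]. *)
Lemma moment_rec S k :
  (INR k + 4) * moment S (k + 2)
  = (2 * INR k + 5) * S * moment S (k + 1)
    + (INR k + 1) * (4 - S ^ 2) * moment S k.
Proof.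
set (F := fun p => cos p ^ 3 * (2 * sin p + S) ^ (k + 1)).
set (f := fun x => (- (INR k + 4)) * (2 * x + S) ^ (k + 2)
   + 1 * ((2 * INR k + 5) * S * (2 * x + S) ^ (k + 1)
   + (INR k + 1) * (4 - S ^ 2) * (2 * x + S) ^ k)).
assert (H : semicircle_int f = 0).
{ unfold semicircle_int; rewrite (RInt_antiderivative (fun p => 2 * F p)).
  - unfold F; rewrite cos_neg, cos_PI2; ring.
  - intros p; unfold F, f; auto_derive; [easy|].
    rewrite !Nat.add_1_r, (Nat.add_comm k 2), S_INR; simpl.
    set (w := (2 * sin p + S) ^ k).
    pose proof (sin2_cos2 p) as E; unfold Rsqr in E.
    assert (E' : cos p * cos p = 1 - sin p * sin p) by lra.
    transitivity (cos p * cos p * w * (4 * (INR k + 1) * (cos p * cos p)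
      - 6 * sin p * (2 * sin p + S))); [ring|].
    replace (cos p * (cos p * 1)) with (cos p * cos p) by ring.
    rewrite E'; ring.
  - intros p; apply (continuous_semicircle f).
    intros x; apply (ex_derive_continuous f); unfold f; auto_derive; easy. }
unfold f in H.
rewrite (semicircle_int_lin (fun x => (2 * x + S) ^ (k + 2))) in H.
- rewrite (semicircle_int_lin (fun x => (2 * x + S) ^ (k + 1))) in H
    by (intros; apply continuous_lin_pow).
  fold (moment S (k + 2)) (moment S (k + 1)) (moment S k) in H; lra.
- intros; apply continuous_lin_pow.
- intros x; apply (ex_derive_continuous (fun x =>
    (2 * INR k + 5) * S * (2 * x + S) ^ (k + 1)
   + (INR k + 1) * (4 - S ^ 2) * (2 * x + S) ^ k)); auto_derive; easy.
Qed.

(** The odd function [x] integrates to zero against the even weight. *)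
Lemma moment_1 S : moment S 1 = S * moment S 0.
Proof.
unfold moment.
rewrite <- (Rplus_0_l (S * _)), <- (Rmult_0_r 2).
replace 0 with (semicircle_int (fun x => x)).
- rewrite <- semicircle_int_lin.
  + apply semicircle_int_ext; intros; simpl; ring.
  + intros; apply continuous_id.
  + intros; apply continuous_lin_pow.
- unfold semicircle_int.
  rewrite (RInt_antiderivative (fun p => - cos p ^ 3 / 3)).
  + rewrite cos_neg, cos_PI2; field.
  + intros p; auto_derive; [easy|simpl; field].
  + intros p; apply (continuous_semicircle (fun x => x)).
    intros; apply continuous_id.
Qed.

(* At step [j], [peval ev (S ^ 2)] and [S * peval od (S ^ 2)] are
   [2 / PI * (k + 2)!] times the [k]-th moment for [k = 2 j] and [k = 2 j - 1];
   this normalisation keeps the recursion free of divisions.  With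
   [fact = (2 j)!], [sum / fact] accumulates the moments, up to the factor
   [2 / PI], against the coefficients of [p]. *)
Fixpoint mom_poly (p : list Z) (j : nat) (ev od sum : list Z) (fact : Z) :
  list Z * Z :=
  match p with
  | [] => (sum, fact)
  | c :: p =>
      let k := (2 * Z.of_nat j)%Z in
      let fact' := ((k + 1) * (k + 2) * fact)%Z in
      let od' := padd (pscale (2 * k + 3) ev)
                      (plin (4 * k * (k + 2)) (- k * (k + 2)) od) in
      let ev' := padd (0%Z :: pscale (2 * k + 5) od')
                      (plin (4 * (k + 1) * (k + 3)) (- (k + 1) * (k + 3)) ev) in
      mom_poly p (S j) ev' od'
        (padd (pscale ((k + 1) * (k + 2)) sum) (pscale c ev)) fact'
  end.

Lemma continuous_peval_shift p S j x :
  continuous (fun x => (2 * x + S) ^ j * peval p ((2 * x + S) ^ 2)) x.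
Proof.
apply (ex_derive_continuous
  (fun x => (2 * x + S) ^ j * peval p ((2 * x + S) ^ 2))).
assert (H : forall y, ex_derive (peval p) y).
{ induction p as [|c p IH]; intros y; simpl.
  - auto_derive; easy.
  - auto_derive; auto. }
auto_derive; auto.
Qed.

(** [X] is the part of the integral already accumulated. At [j = 0] there is no preceding odd
    moment, and the recursion multiplies [od] by zero; [moment_1] starts the odd moments. *)
Lemma mom_poly_correct S p j ev od sum fact X :
  (0 < fact)%Z ->
  PI / 2 * peval ev (S ^ 2)
  = (2 * INR j + 1) * (2 * INR j + 2) * IZR fact * moment S (2 * j) ->
  (j = 0%nat \/
   PI / 2 * S * peval od (S ^ 2)
   = (2 * INR j + 1) * IZR fact * moment S (2 * j - 1)) ->
  PI / 2 * peval sum (S ^ 2) = IZR fact * X ->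
  let r := mom_poly p j ev od sum fact in
  (0 < snd r)%Z /\
  PI / 2 * peval (fst r) (S ^ 2) = IZR (snd r) *
    (X + semicircle_int
           (fun x => (2 * x + S) ^ (2 * j) * peval p ((2 * x + S) ^ 2))).
Proof.
revert j ev od sum fact X.
induction p as [|c p IH]; intros j ev od sum fact X Hf He Ho Hs;
  cbn [mom_poly fst snd].
- split; [exact Hf|].
  rewrite Hs; f_equal.
  transitivity (X + semicircle_int (fun _ => 0 * 1 + 0 * 1)).
  + rewrite semicircle_int_lin by (intros; apply continuous_const); ring.
  + f_equal; apply semicircle_int_ext; intros; simpl; ring.
- set (k := (2 * Z.of_nat j)%Z).
  set (od' := padd (pscale (2 * k + 3) ev) _).
  set (ev' := padd (0%Z :: pscale (2 * k + 5) od') _).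
  assert (Hk : IZR k = 2 * INR j)
    by (unfold k; rewrite mult_IZR, <- INR_IZR_INZ; ring).
  pose proof (pos_INR j) as Hj.
  assert (Ho' : PI / 2 * S * peval od' (S ^ 2) = (2 * INR j + 3) *
    ((2 * INR j + 1) * (2 * INR j + 2) * IZR fact) * moment S (2 * j + 1)).
  { unfold od'; rewrite peval_add, peval_scale, peval_lin.
    rewrite ?mult_IZR, ?plus_IZR, ?mult_IZR, ?opp_IZR, ?plus_IZR, Hk.
    transitivity ((2 * INR j + 1) * (2 * INR j + 2) * IZR fact
      * ((2 * INR j + 3) * moment S (2 * j + 1))); [|ring].
    destruct Ho as [->|Ho].
    - cbn [Nat.mul Nat.add INR] in *.
      transitivity (3 * S * (PI / 2 * peval ev (S ^ 2))); [ring|].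
      rewrite He, moment_1; ring.
    - transitivity ((4 * INR j + 3) * S * (PI / 2 * peval ev (S ^ 2))
        + 2 * INR j * (2 * INR j + 2) * (4 - S ^ 2)
          * (PI / 2 * S * peval od (S ^ 2))); [ring|].
      rewrite He, Ho.
      destruct j as [|i]; [cbn [INR]; rewrite moment_1; simpl; ring|].
      pose proof (moment_rec S (2 * i + 1)) as R.
      rewrite plus_INR, mult_INR in R; simpl (INR 2) in R; simpl (INR 1) in R.
      replace (1 + 1) with 2 in R by ring.
      replace (2 * i + 1 + 2)%nat with (2 * Datatypes.S i + 1)%nat in R by lia.
      replace (2 * i + 1 + 1)%nat with (2 * Datatypes.S i)%nat in R by lia.
      replace (2 * Datatypes.S i - 1)%nat with (2 * i + 1)%nat by lia.
      rewrite S_INR.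
      replace (2 * (INR i + 1) + 3) with (2 * INR i + 1 + 4) by ring.
      rewrite R; ring. }
  assert (He' : PI / 2 * peval ev' (S ^ 2) = (2 * INR j + 3) * (2 * INR j + 4) *
    ((2 * INR j + 1) * (2 * INR j + 2) * IZR fact) * moment S (2 * j + 2)).
  { unfold ev'; rewrite peval_add, peval_lin; cbn [peval].
    rewrite peval_scale.
    rewrite ?mult_IZR, ?plus_IZR, ?mult_IZR, ?opp_IZR, ?plus_IZR, Hk.
    transitivity ((4 * INR j + 5) * S * (PI / 2 * S * peval od' (S ^ 2))
      + (2 * INR j + 1) * (2 * INR j + 3) * (4 - S ^ 2)
        * (PI / 2 * peval ev (S ^ 2))); [ring|].
    rewrite He, Ho'.
    pose proof (moment_rec S (2 * j)) as R.
    rewrite mult_INR in R; simpl (INR 2) in R.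
    replace (1 + 1) with 2 in R by ring.
    transitivity ((2 * INR j + 3) * (2 * INR j + 1) * (2 * INR j + 2) * IZR fact
      * ((2 * INR j + 4) * moment S (2 * j + 2))); [|ring].
    rewrite R; ring. }
  replace (semicircle_int _) with (IZR c * moment S (2 * j) + 1 * semicircle_int
    (fun x => (2 * x + S) ^ (2 * Datatypes.S j) * peval p ((2 * x + S) ^ 2))).
  + rewrite <- (Rplus_assoc X), Rmult_1_l.
    apply IH.
    * unfold k; lia.
    * rewrite He', S_INR, !mult_IZR, !plus_IZR, Hk.
      replace (2 * Datatypes.S j)%nat with (2 * j + 2)%nat by lia; ring.
    * right; rewrite Ho', S_INR, !mult_IZR, !plus_IZR, Hk.
      replace (2 * Datatypes.S j - 1)%nat with (2 * j + 1)%nat by lia; ring.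
    * rewrite peval_add, !peval_scale, !mult_IZR, !plus_IZR, Hk.
      transitivity ((2 * INR j + 1) * (2 * INR j + 2) * (PI / 2 * peval sum (S ^ 2))
        + IZR c * (PI / 2 * peval ev (S ^ 2))); [ring|].
      rewrite Hs, He; ring.
  + unfold moment; rewrite <- semicircle_int_lin.
    * apply semicircle_int_ext; intros x; simpl peval.
      replace (2 * Datatypes.S j)%nat with (2 + 2 * j)%nat by lia.
      rewrite (pow_add _ 2 (2 * j)); ring.
    * intros; apply continuous_lin_pow.
    * intros; apply continuous_peval_shift.
Qed.

(** * Lower bounds for the elliptic integral *)

(** Ten terms of the alternating series for [PI / 4 = 2 atan (1/3) + atan (1/7)]. *)
Lemma PI_lower_bound : 3.14159265 <= PI.
Proof.
destruct (PI_2_3_7_ineq 4) as [H _].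
unfold PI_2_3_7_tg, tg_alt, Ratan_seq in H; simpl in H; lra.
Qed.

Definition C0 : R := 162278 / 1000000.

(** The integral of [sqrt P] over the normalised range, with [t = tau + x]: the factor of [P]
    vanishing at the ends becomes the semicircle weight. *)
Definition phase_integral (tau d : R) : R :=
  semicircle_int (fun x => sqrt ((x + 2 * tau) ^ 2 + d ^ 2)).

Lemma continuous_phase tau d x :
  continuous (fun x => sqrt ((x + 2 * tau) ^ 2 + d ^ 2)) x.
Proof.
apply continuous_sqrt_comp,
  (ex_derive_continuous (fun x => (x + 2 * tau) ^ 2 + d ^ 2)).
auto_derive; easy.
Qed.

(* Cauchy's inequality makes the bound linear in [d], at the price of the
   factor [1 / sqrt (y ^ 2 + c)], which is then replaced by a partial sum of
   its binomial series around [y ^ 2 + c = kap]. *)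
Lemma sqrt_lower_bound (P Q D y d : R) m :
  0 < Q -> 0 < D -> P < D -> 0 <= d ->
  let kap := D / (4 * Q) in
  let c := (D - P) / (4 * Q) in
  (y ^ 2 + d * sqrt c) * isqrt_series (S (2 * m)) ((P - Q * (2 * y) ^ 2) / D)
    / sqrt kap
  <= sqrt (y ^ 2 + d ^ 2).
Proof.
intros HQ HD HP Hd kap c.
assert (Hkap : 0 < kap) by (apply Rdiv_lt_0_compat; lra).
assert (Hc : 0 < c) by (apply Rdiv_lt_0_compat; lra).
set (v := (P - Q * (2 * y) ^ 2) / D).
assert (Hv : 1 - v = (y ^ 2 + c) / kap)
  by (unfold v, c, kap; field; lra).
pose proof (pow2_ge_0 y) as Hy.
assert (Hpos : 0 < (y ^ 2 + c) / kap) by (apply Rdiv_lt_0_compat; lra).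
pose proof (isqrt_series_le m v ltac:(lra)) as Hser.
rewrite Hv, sqrt_div_alt in Hser by exact Hkap.
set (q := isqrt_series (S (2 * m)) v) in *.
assert (Hsk : 0 < sqrt kap) by now apply sqrt_lt_R0.
assert (Hsc : 0 < sqrt c) by now apply sqrt_lt_R0.
set (e := sqrt (y ^ 2 + c)) in *.
assert (He : 0 < e) by (apply sqrt_lt_R0; lra).
(* Cauchy for the vectors [(y, d)] and [(y, sqrt c)], with equality at [d = sqrt c]. *)
assert (Hcs : y ^ 2 + d * sqrt c <= sqrt (y ^ 2 + d ^ 2) * e).
{ unfold e; rewrite <- sqrt_mult by nra.
  apply Rsqr_incr_0_var; [|apply sqrt_pos].
  pose proof (sqrt_sqrt c ltac:(lra)) as Hss.
  rewrite Rsqr_sqrt; [|apply Rmult_le_pos; nra].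
  set (s := sqrt c) in *; rewrite <- Hss; unfold Rsqr.
  pose proof (Rle_0_sqr (y * (d - s))) as Hq; unfold Rsqr in Hq; nra. }
assert (0 <= y ^ 2 + d * sqrt c) by nra.
apply Rle_trans with ((y ^ 2 + d * sqrt c) / e).
- unfold Rdiv; rewrite Rmult_assoc.
  apply Rmult_le_compat_l; [assumption|].
  apply (Rmult_le_reg_r e); [assumption|].
  rewrite Rinv_l by lra.
  replace (q * / sqrt kap * e) with (q * (e / sqrt kap)) by (field; lra).
  exact Hser.
- apply (Rmult_le_reg_r e); [assumption|].
  unfold Rdiv; rewrite Rmult_assoc, Rinv_l, Rmult_1_r; lra.
Qed.

(** The seed 2 is [2!] times the normalised zeroth moment, which is 1. *)
Definition semicircle_poly (p : list Z) : list Z * Z :=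
  mom_poly p 0 [2%Z] [] [] 1.

Lemma semicircle_poly_correct S p :
  (0 < snd (semicircle_poly p))%Z /\
  semicircle_int (fun x => peval p ((2 * x + S) ^ 2))
  = PI / 2 * peval (fst (semicircle_poly p)) (S ^ 2)
    / IZR (snd (semicircle_poly p)).
Proof.
destruct (mom_poly_correct S p 0 [2%Z] [] [] 1 0) as [H1 H2].
- reflexivity.
- simpl (2 * 0)%nat; rewrite moment_0; simpl; field.
- now left.
- simpl; ring.
- fold (semicircle_poly p) in *; split; [exact H1|].
  apply IZR_lt in H1.
  rewrite H2, Rplus_0_l; field_simplify; [|lra].
  apply semicircle_int_ext; intros; simpl; ring.
Qed.

(* All coefficients [ka], ..., [b1] are in units of [10 ^ -9];
   314159265 / 10 ^ 8 is a lower bound of [PI]. *)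
Definition linear_bound_check (n : nat) (P Q D ka kb a0 a1 b0 b1 A B E : Z) :
  bool :=
  let s := series_poly P Q D n in
  let pa := semicircle_poly (0%Z :: ser_num s) in
  let pb := semicircle_poly (ser_num s) in
  (pnonneg A B E (padd (pscale ka (fst pa))
     (pscale (- (ser_den s * snd pa)) [a0; a1]))
   && pnonneg A B E (padd (pscale kb (fst pb))
     (pscale (- (ser_den s * snd pb)) [b0; b1]))
   && pnonneg A B E [a0; a1] && pnonneg A B E [b0; b1]
   && (ka ^ 2 * (40000 * D) <=? 162278 * 314159265 ^ 2 * Q)%Z
   && (kb ^ 2 * (40000 * D) <=? 162278 * 314159265 ^ 2 * (D - P))%Z
   && (0 <? ka)%Z && (0 <? kb)%Z
   && (0 <? Q)%Z && (0 <? D)%Z && (P <? D)%Z && (0 <? E)%Z)%bool.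

(** The integer hypothesis is the squared claim with denominators cleared and [PI] replaced by its
    decimal lower bound. *)
Lemma sqrt_C0_factor (k D X : Z) :
  (0 < k)%Z -> (0 < D)%Z ->
  (k ^ 2 * (40000 * D) <= 162278 * 314159265 ^ 2 * X)%Z ->
  IZR k / 10 ^ 9 <= sqrt (C0 * (IZR X / IZR D)) * (PI / 2).
Proof.
intros Hk HD H.
apply IZR_lt in Hk; apply IZR_lt in HD.
apply IZR_le in H; rewrite !mult_IZR, <- !(pow_IZR _ 2) in H.
assert (HX : 0 < IZR X).
{ assert (0 < IZR k ^ 2 * (40000 * IZR D))
    by (apply Rmult_lt_0_compat; [apply pow_lt|]; lra).
  lra. }
assert (Hpi : 314159265 ^ 2 <= (PI * 10 ^ 8) ^ 2).
{ apply pow_incr; pose proof PI_lower_bound; lra. }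
pose proof PI_RGT_0.
rewrite <- (sqrt_Rsqr (PI / 2)) by lra.
rewrite <- sqrt_mult.
- apply Rsqr_incr_0_var; [|apply sqrt_pos].
  rewrite Rsqr_sqrt.
  + apply (Rmult_le_reg_r (IZR D * 4 * 10 ^ 18)); [lra|].
    unfold Rsqr, C0.
    replace (IZR k / 10 ^ 9 * (IZR k / 10 ^ 9) * (IZR D * 4 * 10 ^ 18))
      with (IZR k ^ 2 * (40000 * IZR D) / 10 ^ 4) by field.
    replace (162278 / 1000000 * (IZR X / IZR D) * (PI / 2 * (PI / 2))
      * (IZR D * 4 * 10 ^ 18))
      with (162278 * (PI * 10 ^ 8) ^ 2 * IZR X / 10 ^ 4) by (field; lra).
    apply (Rmult_le_compat_r (IZR X)) in Hpi; lra.
  + apply Rmult_le_pos; [|apply Rle_0_sqr].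
    unfold C0; apply Rmult_le_pos; [lra|].
    apply Rlt_le, Rdiv_lt_0_compat; lra.
- unfold C0; apply Rmult_le_pos; [lra|].
  apply Rlt_le, Rdiv_lt_0_compat; lra.
- apply Rle_0_sqr.
Qed.

(** Replacing [f] by its lower bound needs [p >= 0], which follows from [l >= 0]; hence the sign
    tests on the affine bounds in [linear_bound_check]. *)
Lemma scaled_bound (k f p w l N : R) :
  0 < k -> 0 < w -> 0 < N -> 0 <= l -> 0 <= k * p + - w * l -> k / N <= f ->
  l / N <= f * (p / w).
Proof.
intros Hk Hw HN Hl H Hf.
assert (Hp : 0 <= p) by (apply (Rmult_le_reg_l k); nra).
apply Rle_trans with (k / N * (p / w)).
- apply (Rmult_le_reg_r (N * w)); [nra|].
  replace (l / N * (N * w)) with (l * w) by (field; lra).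
  replace (k / N * (p / w) * (N * w)) with (k * p) by (field; lra).
  lra.
- apply Rmult_le_compat_r; [|exact Hf].
  apply Rmult_le_pos; [exact Hp|apply Rlt_le, Rinv_0_lt_compat, Hw].
Qed.

(** Integrating [sqrt_lower_bound] exactly gives two polynomials in [s], one of them multiplied by
    [d]; the check bounds each below by an affine function. *)
Lemma linear_bound m P Q D ka kb a0 a1 b0 b1 A B E :
  linear_bound_check (S (2 * m)) P Q D ka kb a0 a1 b0 b1 A B E = true ->
  forall tau d, 0 <= d ->
  let s := 16 * tau ^ 2 in
  IZR A <= IZR E * s < IZR B ->
  (IZR a0 + IZR a1 * s) / 10 ^ 9 + 2 * d * ((IZR b0 + IZR b1 * s) / 10 ^ 9)
  <= 2 * sqrt C0 * phase_integral tau d.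
Proof.
unfold linear_bound_check.
set (n := S (2 * m)).
pose proof (fun z HD => series_poly_correct P Q D n z HD) as Hser.
set (st := series_poly P Q D n) in *.
cbn zeta in *.
rewrite !Bool.andb_true_iff, !Z.ltb_lt, !Z.leb_le.
intros [[[[[[[[[[[Ha Hb] Ha'] Hb'] Hka] Hkb] ka0] kb0] HQ] HD] HP] HE] tau d Hd Hs.
set (s := 16 * tau ^ 2) in *.
assert (Hden : 0 < IZR (ser_den st)) by apply IZR_lt, (Hser 0 HD).
apply sqrt_C0_factor in Hka; [|assumption|assumption].
apply sqrt_C0_factor in Hkb; [|assumption|assumption].
apply (pnonneg_correct A B E _ s HE) in Ha; [|exact Hs].
apply (pnonneg_correct A B E _ s HE) in Hb; [|exact Hs].
apply (pnonneg_correct A B E _ s HE) in Ha'; [|exact Hs].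
apply (pnonneg_correct A B E _ s HE) in Hb'; [|exact Hs].
rewrite peval_add, !peval_scale, opp_IZR, mult_IZR in Ha, Hb.
replace (peval [a0; a1] s) with (IZR a0 + IZR a1 * s) in * by (simpl; ring).
replace (peval [b0; b1] s) with (IZR b0 + IZR b1 * s) in * by (simpl; ring).
destruct (semicircle_poly_correct (4 * tau) (0%Z :: ser_num st)) as [Na Ea].
destruct (semicircle_poly_correct (4 * tau) (ser_num st)) as [Nb Eb].
replace ((4 * tau) ^ 2) with s in Ea, Eb by (unfold s; ring).
set (pa := peval (fst (semicircle_poly (0%Z :: ser_num st))) s) in *.
set (pb := peval (fst (semicircle_poly (ser_num st))) s) in *.
apply IZR_lt in Na; apply IZR_lt in Nb.
set (na := IZR (snd (semicircle_poly (0%Z :: ser_num st)))) in *.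
set (nb := IZR (snd (semicircle_poly (ser_num st)))) in *.
apply IZR_lt in ka0; apply IZR_lt in kb0; apply IZR_lt in HP.
assert (HQ' := IZR_lt _ _ HQ); assert (HD' := IZR_lt _ _ HD).
assert (HDP : IZR (D - P) = IZR D - IZR P) by apply minus_IZR.
rewrite HDP in Hkb.
set (kap := IZR D / (4 * IZR Q)).
set (c := (IZR D - IZR P) / (4 * IZR Q)).
assert (Hkap : 0 < kap) by (apply Rdiv_lt_0_compat; lra).
assert (Hc : 0 < c) by (apply Rdiv_lt_0_compat; lra).
set (den := IZR (ser_den st)) in *.
assert (Hsk : 0 < sqrt kap) by now apply sqrt_lt_R0.
assert (HC0 : 0 < C0) by (unfold C0; lra).
assert (HJ : / (den * sqrt kap) * (/ 4 * (PI / 2 * pa / na)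
  + d * sqrt c * (PI / 2 * pb / nb)) <= phase_integral tau d).
{ unfold phase_integral.
  (* The leading zero coefficient multiplies by [(2 y) ^ 2], and the quarter turns this into
     [y ^ 2]. *)
  replace (_ * _) with (/ (den * sqrt kap) * / 4 *
      semicircle_int (fun x =>
        peval (0%Z :: ser_num st) ((2 * x + 4 * tau) ^ 2))
    + / (den * sqrt kap) * (d * sqrt c) *
      semicircle_int (fun x => peval (ser_num st) ((2 * x + 4 * tau) ^ 2)))
    by (rewrite Ea, Eb; field; repeat split; lra).
  assert (Hcont : forall p x,
    continuous (fun x => peval p ((2 * x + 4 * tau) ^ 2)) x).
  { intros p x.
    apply (continuous_ext (fun x => (2 * x + 4 * tau) ^ 0
      * peval p ((2 * x + 4 * tau) ^ 2))); [intros; simpl; ring|].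
    apply continuous_peval_shift. }
  rewrite <- semicircle_int_lin by (intros; apply Hcont).
  apply semicircle_int_le.
  - intros x.
    apply @continuous_plus; apply @continuous_scal_r; apply Hcont.
  - apply continuous_phase.
  - intros x.
    eapply Rle_trans;
      [|apply (sqrt_lower_bound (IZR P) (IZR Q) (IZR D) (x + 2 * tau) d m);
        assumption].
    destruct (Hser ((2 * x + 4 * tau) ^ 2) HD) as [_ [_ [_ Hnum]]].
    cbn [peval]; rewrite Hnum; fold n kap c den.
    replace (2 * (x + 2 * tau)) with (2 * x + 4 * tau) by ring.
    right; field; lra. }
pose proof (sqrt_sqrt C0 ltac:(lra)) as HssC.
pose proof (sqrt_sqrt kap ltac:(lra)) as Hssk.
pose proof (sqrt_sqrt c ltac:(lra)) as Hssc.
pose proof (sqrt_pos C0); pose proof (sqrt_pos c).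
(* The ratios tested by the check are [Q / D = 1 / (4 kap)] and [(D - P) / D = c / kap]. *)
assert (HeqA : sqrt (C0 * (IZR Q / IZR D)) = sqrt C0 / (2 * sqrt kap)).
{ apply sqrt_lem_1.
  - apply Rmult_le_pos; [lra|apply Rlt_le, Rdiv_lt_0_compat; lra].
  - apply Rmult_le_pos; [lra|apply Rlt_le, Rinv_0_lt_compat; lra].
  - replace (_ * _) with (sqrt C0 * sqrt C0 / (4 * (sqrt kap * sqrt kap)))
      by (field; lra).
    rewrite HssC, Hssk; unfold kap; field; lra. }
assert (HeqB : sqrt (C0 * ((IZR D - IZR P) / IZR D)) = sqrt C0 * sqrt c / sqrt kap).
{ apply sqrt_lem_1.
  - apply Rmult_le_pos; [lra|apply Rlt_le, Rdiv_lt_0_compat; lra].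
  - apply Rmult_le_pos; [nra|apply Rlt_le, Rinv_0_lt_compat; lra].
  - replace (_ * _)
      with (sqrt C0 * sqrt C0 * (sqrt c * sqrt c) / (sqrt kap * sqrt kap))
      by (field; lra).
    rewrite HssC, Hssk, Hssc; unfold c, kap; field; lra. }
rewrite HeqA in Hka; rewrite HeqB in Hkb.
eapply Rle_trans;
  [|apply Rmult_le_compat_l; [|exact HJ]; lra].
replace (2 * sqrt C0 * _)
  with (sqrt C0 / (2 * sqrt kap) * (PI / 2) * (pa / (den * na))
    + 2 * d * (sqrt C0 * sqrt c / sqrt kap * (PI / 2) * (pb / (den * nb))))
  by (field; repeat split; lra).
apply Rplus_le_compat.
- apply (scaled_bound (IZR ka)); try lra; now apply Rmult_lt_0_compat.
- apply Rmult_le_compat_l; [lra|].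
  apply (scaled_bound (IZR kb)); try lra; now apply Rmult_lt_0_compat.
Qed.

(** * The two-parameter inequality *)

(** A concave function lies above its chord. *)
Lemma concave_nonneg (k0 k1 k2 l r x : R) :
  0 <= k2 -> l <= x <= r ->
  0 <= k0 + k1 * l - k2 * l ^ 2 -> 0 <= k0 + k1 * r - k2 * r ^ 2 ->
  0 <= k0 + k1 * x - k2 * x ^ 2.
Proof.
intros Hk Hx Hl Hr.
destruct (Req_dec l r) as [E|E].
{ replace x with l by lra; exact Hl. }
apply (Rmult_le_reg_l (r - l)); [lra|].
rewrite Rmult_0_r.
replace ((r - l) * _) with ((r - x) * (k0 + k1 * l - k2 * l ^ 2)
  + (x - l) * (k0 + k1 * r - k2 * r ^ 2)
  + k2 * ((x - l) * (r - x) * (r - l))) by ring.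
repeat apply Rplus_le_le_0_compat; repeat apply Rmult_le_pos; lra.
Qed.

(* With [b ^ 2] the mean of [u ^ 2], the inequality reads
   [lam b ^ 2 + e <= 2 sqrt C0 b phase_integral], where [lam] and [e] are the
   coefficients of [t ^ 2] and [1] in the quartic [P] built from [tau], [d]. *)
Definition good_shape (tau b d : R) : Prop :=
  0 <= d /\
  b ^ 2 * (1 + 2 * tau ^ 2 - d ^ 2) + (1 - tau ^ 2) * (tau ^ 2 + d ^ 2)
  <= 2 * sqrt C0 * b * phase_integral tau d.

(* The slack of [good_shape] at [s = 16 tau ^ 2] when [2 sqrt C0 phase_integral]
   is replaced by [a0 + a1 s + 2 d (b0 + b1 s)] and [s ^ 2] by its tangent at
   [s1]; it is affine in [s] and, for [d ^ 2 <= 1 + s / 8], concave in [b]. *)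
Definition shape_defect (a0 a1 b0 b1 d s1 s b : R) : R :=
  b * (a0 + a1 * s) + 2 * d * b * (b0 + b1 * s) - b ^ 2 * (1 + s / 8 - d ^ 2)
  - (d ^ 2 + s / 16 - d ^ 2 * s / 16 - (2 * s1 * s - s1 ^ 2) / 256).

(** Concavity in [b] on the edges [s = s1] and [s = s2], then affinity in [s], reduce the rectangle
    to its four corners. *)
Lemma shape_defect_nonneg a0 a1 b0 b1 d s1 s2 l r s b :
  d ^ 2 <= 1 + s1 / 8 -> s1 <= s <= s2 -> l <= b <= r ->
  0 <= shape_defect a0 a1 b0 b1 d s1 s1 l ->
  0 <= shape_defect a0 a1 b0 b1 d s1 s1 r ->
  0 <= shape_defect a0 a1 b0 b1 d s1 s2 l ->
  0 <= shape_defect a0 a1 b0 b1 d s1 s2 r ->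
  0 <= shape_defect a0 a1 b0 b1 d s1 s b.
Proof.
intros Hd Hs Hb H1 H2 H3 H4.
assert (Hc : forall t, s1 <= t ->
  0 <= shape_defect a0 a1 b0 b1 d s1 t l ->
  0 <= shape_defect a0 a1 b0 b1 d s1 t r ->
  0 <= shape_defect a0 a1 b0 b1 d s1 t b).
{ intros t Ht Hl Hr; unfold shape_defect in *.
  pose proof (concave_nonneg
    (- (d ^ 2 + t / 16 - d ^ 2 * t / 16 - (2 * s1 * t - s1 ^ 2) / 256))
    (a0 + a1 * t + 2 * d * (b0 + b1 * t)) (1 + t / 8 - d ^ 2) l r b
    ltac:(lra) Hb ltac:(lra) ltac:(lra)); lra. }
pose proof (concave_nonneg
  (b * a0 + 2 * d * b * b0 - b ^ 2 * (1 - d ^ 2) - d ^ 2 - s1 ^ 2 / 256)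
  (b * a1 + 2 * d * b * b1 - b ^ 2 / 8 - / 16 + d ^ 2 / 16 + s1 / 128) 0
  s1 s2 s ltac:(lra) Hs) as H.
pose proof (Hc s1 ltac:(lra) H1 H2) as Hc1.
pose proof (Hc s2 ltac:(lra) H3 H4) as Hc2.
unfold shape_defect in *; lra.
Qed.

(** A certificate for adjacent [b]-intervals starting at [l]: each row holds the [d] to use and the
    right end, from which the next row starts. *)
Fixpoint rows_ok (a0 a1 b0 b1 s1 s2 l : R) (rows : list (R * R)) : Prop :=
  match rows with
  | [] => True
  | (d, r) :: rows =>
      0 <= d /\ d ^ 2 <= 1 + s1 / 8 /\
      0 <= shape_defect a0 a1 b0 b1 d s1 s1 l /\
      0 <= shape_defect a0 a1 b0 b1 d s1 s1 r /\
      0 <= shape_defect a0 a1 b0 b1 d s1 s2 l /\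
      0 <= shape_defect a0 a1 b0 b1 d s1 s2 r /\
      rows_ok a0 a1 b0 b1 s1 s2 r rows
  end.

Lemma rows_ok_correct a0 a1 b0 b1 s1 s2 l rows s b :
  rows_ok a0 a1 b0 b1 s1 s2 l rows -> s1 <= s <= s2 ->
  l < b <= last (map snd rows) l ->
  exists d, 0 <= d /\ 0 <= shape_defect a0 a1 b0 b1 d s1 s b.
Proof.
revert l; induction rows as [|[d r] rows IH]; intros l Hrows Hs Hb.
- simpl in Hb; lra.
- destruct Hrows as [Hd [Hd2 [H1 [H2 [H3 [H4 Hrows]]]]]].
  destruct (Rle_dec b r).
  + exists d; split; [exact Hd|].
    apply (shape_defect_nonneg _ _ _ _ _ _ s2 l r); auto; lra.
  + apply (IH r Hrows Hs); split; [lra|].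
    (* The default of [last] changes from [l] to [r]: it is returned only when no row remains, and
       then the last end is [r]. *)
    replace (last (map snd rows) r) with (last (map snd ((d, r) :: rows)) l);
      [apply Hb|].
    destruct rows as [|y rows]; [reflexivity|].
    simpl; clear; revert y; induction rows as [|z rows IH]; intros y;
      [reflexivity|apply IH].
Qed.

Lemma good_shape_rows m P Q D ka kb a0 a1 b0 b1 A B E l rows tau b :
  linear_bound_check (S (2 * m)) P Q D ka kb a0 a1 b0 b1 A B E = true ->
  (0 < E)%Z -> IZR A <= IZR E * (16 * tau ^ 2) < IZR B ->
  0 <= l -> l < b <= last (map snd rows) l ->
  rows_ok (IZR a0 / 10 ^ 9) (IZR a1 / 10 ^ 9) (IZR b0 / 10 ^ 9) (IZR b1 / 10 ^ 9)
    (IZR A / IZR E) (IZR B / IZR E) l rows ->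
  exists d, good_shape tau b d.
Proof.
intros Hcheck HE Hs Hl Hb Hrows; apply IZR_lt in HE.
set (s := 16 * tau ^ 2) in *.
set (s1 := IZR A / IZR E) in *.
assert (Hs' : s1 <= s <= IZR B / IZR E).
{ unfold s1; split; apply (Rmult_le_reg_l (IZR E)); auto;
    [replace (IZR E * (IZR A / IZR E)) with (IZR A) by (field; lra)
    |replace (IZR E * (IZR B / IZR E)) with (IZR B) by (field; lra)]; lra. }
destruct (rows_ok_correct _ _ _ _ _ _ _ _ s b Hrows Hs' Hb) as [d [Hd H]].
exists d; split; [exact Hd|].
unfold shape_defect in H.
pose proof (linear_bound _ _ _ _ _ _ _ _ _ _ _ _ _ Hcheck tau d Hd Hs) as Hlin.
fold s in Hlin.
apply (Rmult_le_compat_l b) in Hlin; [|lra].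
(* This puts [s ^ 2] above its tangent at [s1], so the true slack is at least [shape_defect]. *)
pose proof (pow2_ge_0 (s - s1)).
replace (tau ^ 2) with (s / 16) by (unfold s; field).
lra.
Qed.

Ltac solve_rows :=
  [> vm_compute; reflexivity | reflexivity | lra | lra | simpl; lra
   | simpl; unfold shape_defect; repeat split; lra ].

(* The parameters and the rows [(d, r)], each valid up to [b = r], were found
   numerically.  The slack is smallest, about [10 ^ -7], at [tau = 0],
   [b = 0.6398], [d = 0.5389], the extremal of the inequality. *)
Lemma good_shape_1 tau b :
  0 <= 16 * tau ^ 2 < 1 / 20 -> 0.201 < b <= 1 ->
  exists d, good_shape tau b d.
Proof.
intros Hs Hb.
(* Here [c = (80 - 51) / 100 = 0.29], so Cauchy is nearly sharp at the critical [d = 0.5389]; the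
   series has degree 25. *)
apply (good_shape_rows 12 51 25 80 353732294 380981340
    371823478 211000000 497386256 (-48300000)
    0 1 20 0.201
    [(0.31, 0.564021); (0.5128, 0.632679); (0.5366, 0.639297);
     (0.5389, 0.640237); (0.5403, 0.643976); (0.5542, 0.688363); (0.64, 1)]);
  solve_rows.
Qed.

Lemma good_shape_2 tau b :
  1 / 20 <= 16 * tau ^ 2 < 1 / 2 -> 0.212 < b <= 0.999 ->
  exists d, good_shape tau b d.
Proof.
intros Hs Hb.
apply (good_shape_rows 6 14 5 20 316387782 346585450
    369520000 200900000 499730000 (-48600000)
    1 10 20 0.212
    [(0.29, 0.5542); (0.5081, 0.6308); (0.5425, 0.6528); (0.59, 0.7932);
     (0.65, 0.999)]);
  solve_rows.
Qed.

Lemma good_shape_3 tau b :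
  1 / 2 <= 16 * tau ^ 2 < 2 -> 0.237 < b <= 0.985 ->
  exists d, good_shape tau b d.
Proof.
intros Hs Hb.
apply (good_shape_rows 6 16 3 20 245072922 282985835
    366160000 195600000 502250000 (-42900000)
    10 40 20 0.237
    [(0.18, 0.498); (0.48, 0.624); (0.5569, 0.704); (0.67, 0.985)]);
  solve_rows.
Qed.

Lemma good_shape_4 tau b :
  2 <= 16 * tau ^ 2 < 4 -> 0.272 < b <= 0.936 ->
  exists d, good_shape tau b d.
Proof.
intros Hs Hb.
apply (good_shape_rows 4 14 2 16 223719946 223719946
    441940000 169900000 440820000 (-32600000)
    40 80 20 0.272
    [(0.17, 0.54); (0.5271, 0.671); (0.66, 0.859); (0.7, 0.936)]);
  solve_rows.
Qed.

Lemma good_shape_5 tau b :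
  4 <= 16 * tau ^ 2 < 9 -> 0.302 < b <= 0.867 ->
  exists d, good_shape tau b d.
Proof.
intros Hs Hb.
apply (good_shape_rows 4 15 1 16 158193891 158193891
    581330000 134100000 351690000 (-15800000)
    80 180 20 0.302
    [(0.32, 0.633); (0.69, 0.867)]);
  solve_rows.
Qed.

Lemma good_shape_6 tau b :
  9 <= 16 * tau ^ 2 < 13.7 -> 0.352 < b <= 0.662 ->
  exists d, good_shape tau b d.
Proof.
intros Hs Hb.
apply (good_shape_rows 1 15 1 16 158193891 158193891
    895610000 94600000 257240000 (-7100000)
    180 274 20 0.352
    [(0.09, 0.662)]);
  solve_rows.
Qed.

(** * Calibration *)

(** Six strips in [16 tau ^ 2]; on each, the two hypotheses confine [b] to the certified
    interval. *)
Lemma exists_good_shape tau b :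
  0.2014 * (1 + Rabs tau) <= b -> b ^ 2 <= 1 - tau ^ 2 ->
  exists d, good_shape tau b d.
Proof.
intros Hb Hb2.
set (t := Rabs tau) in *.
assert (Ht0 : 0 <= t) by apply Rabs_pos.
assert (Ht : tau ^ 2 = t ^ 2) by (symmetry; apply pow2_abs).
rewrite Ht in Hb2.
assert (lower : forall x, 0 <= x -> x ^ 2 <= t ^ 2 -> x <= t).
{ intros x Hx Hxt; apply Rsqr_incr_0_var; [unfold Rsqr; lra|exact Ht0]. }
assert (upper : forall y, 0 <= y -> b ^ 2 <= y ^ 2 -> b <= y).
{ intros y Hy Hby; apply Rsqr_incr_0_var; [unfold Rsqr; lra|exact Hy]. }
(* For [t >= 0.9252] the lower and upper bounds on [b] contradict each other. *)
assert (Hs : 16 * tau ^ 2 < 13.7).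
{ rewrite Ht; enough (t < 0.9252) by nra.
  apply Rnot_le_lt; intros H.
  assert (0.2014 * (1 + 0.9252) <= b) by lra.
  nra. }
destruct (Rlt_dec (16 * tau ^ 2) (1 / 20)).
{ apply good_shape_1; [split; [nra|lra]|].
  split; [lra|apply upper; nra]. }
destruct (Rlt_dec (16 * tau ^ 2) (1 / 2)).
{ apply good_shape_2; [lra|].
  pose proof (lower 0.0559 ltac:(lra) ltac:(lra)).
  split; [lra|apply upper; lra]. }
destruct (Rlt_dec (16 * tau ^ 2) 2).
{ apply good_shape_3; [lra|].
  pose proof (lower 0.17677 ltac:(lra) ltac:(lra)).
  split; [lra|apply upper; lra]. }
destruct (Rlt_dec (16 * tau ^ 2) 4).
{ apply good_shape_4; [lra|].
  pose proof (lower 0.3535 ltac:(lra) ltac:(lra)).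
  split; [lra|apply upper; lra]. }
destruct (Rlt_dec (16 * tau ^ 2) 9).
{ apply good_shape_5; [lra|].
  pose proof (lower 0.5 ltac:(lra) ltac:(lra)).
  split; [lra|apply upper; lra]. }
apply good_shape_6; [lra|].
pose proof (lower 0.75 ltac:(lra) ltac:(lra)).
split; [lra|apply upper; lra].
Qed.

Lemma is_derive_continuous (f : R -> R) x l : is_derive f x l -> continuous f x.
Proof. intros H; apply (ex_derive_continuous f); now exists l. Qed.

(* [theta U'^2 + P(U) >= 2 sqrt(theta) |U'| g(U)], and the right-hand side is
   the derivative of an antiderivative of [g] along [U]. *)
Lemma calibration (L : R) (U U' P g : R -> R) theta x1 x2 :
  (forall x, is_derive U x (U' x)) -> (forall x, continuous U' x) ->
  0 <= theta ->
  (forall t, continuous P t) -> (forall t, continuous g t) ->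
  (forall x, 0 <= x <= L -> g (U x) ^ 2 <= P (U x)) ->
  0 <= x1 <= L -> 0 <= x2 <= L ->
  2 * sqrt theta * RInt g (U x1) (U x2)
  <= RInt (fun x => theta * U' x ^ 2 + P (U x)) 0 L.
Proof.
intros U_derive U'_continuous Hth HP Hg Hle.
assert (U_continuous : forall x, continuous U x)
  by (intros x; apply (is_derive_continuous U x (U' x)), U_derive).
set (F := fun x => theta * U' x ^ 2 + P (U x)).
assert (HF : forall x, continuous F x).
{ intros x; apply @continuous_plus.
  - apply @continuous_scal_r.
    apply (continuous_comp U' (fun y => y ^ 2)); [apply U'_continuous|].
    apply (ex_derive_continuous (fun y => y ^ 2)); auto_derive; easy.
  - apply (continuous_comp U P); [apply U_continuous|apply HP]. }
set (e := fun x => U' x * g (U x)).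
assert (He : forall x, continuous e x).
{ intros x; apply (continuous_mult U' (fun x => g (U x))); [apply U'_continuous|].
  apply (continuous_comp U g); [apply U_continuous|apply Hg]. }
assert (Hs : sqrt theta * sqrt theta = theta) by now apply sqrt_sqrt.
(* The sign [k] covers both orders of [x1] and [x2]. *)
assert (Hsq : forall x, 0 <= x <= L -> forall k, k ^ 2 = 1 ->
  0 <= F x + k * (2 * sqrt theta * e x)).
{ intros x Hx k Hk; specialize (Hle x Hx); unfold F, e.
  pose proof (pow2_ge_0 (sqrt theta * U' x + k * g (U x))) as Hsq.
  replace ((sqrt theta * U' x + k * g (U x)) ^ 2) with
    (sqrt theta * sqrt theta * U' x ^ 2 + k * (2 * sqrt theta * (U' x * g (U x)))
     + k ^ 2 * g (U x) ^ 2) in Hsq by ring.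
  rewrite Hs, Hk in Hsq; lra. }
assert (Hsub : forall a b, 0 <= a -> a <= b -> b <= L -> RInt F a b <= RInt F 0 L).
{ intros a b Ha Hab Hb.
  assert (Hpos : forall a b, 0 <= a -> a <= b -> b <= L -> 0 <= RInt F a b).
  { intros a' b' Ha' Hab' Hb'; apply RInt_ge_0; [lra|now apply ex_RInt_cont|].
    intros x Hx; unfold F.
    assert (Hx' : 0 <= x <= L) by lra.
    pose proof (Hle x Hx'); pose proof (pow2_ge_0 (g (U x))).
    pose proof (Rmult_le_pos _ _ Hth (pow2_ge_0 (U' x))); lra. }
  rewrite <- (RInt_Chasles F 0 a L), <- (RInt_Chasles F a b L)
    by now apply ex_RInt_cont.
  pose proof (Hpos 0 a ltac:(lra) ltac:(lra) ltac:(lra)).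
  pose proof (Hpos b L ltac:(lra) ltac:(lra) ltac:(lra)).
  unfold plus; simpl; lra. }
assert (Hcomp : forall a b, RInt e a b = RInt g (U a) (U b)).
{ intros a b; rewrite <- (RInt_comp g U U').
  - reflexivity.
  - intros; apply Hg.
  - intros; split; [apply U_derive|apply U'_continuous]. }
assert (Hord : forall a b k, 0 <= a -> a <= b -> b <= L -> k ^ 2 = 1 ->
  - k * (2 * sqrt theta * RInt e a b) <= RInt F 0 L).
{ intros a b k Ha Hab Hb Hk.
  apply Rle_trans with (RInt F a b); [|now apply Hsub].
  replace (- k * (2 * sqrt theta * RInt e a b))
    with (RInt (fun x => scal (- k * (2 * sqrt theta)) (e x)) a b).
  - apply RInt_le; [lra| |now apply ex_RInt_cont|].
    + apply (ex_RInt_scal (V := R_NormedModule)); now apply ex_RInt_cont.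
    + intros x Hx; specialize (Hsq x ltac:(lra) k Hk).
      unfold scal; simpl; unfold mult; simpl; lra.
  - rewrite (RInt_scal (V := R_CompleteNormedModule)) by now apply ex_RInt_cont.
    unfold scal; simpl; unfold mult; simpl; ring. }
intros H1 H2; rewrite <- Hcomp.
destruct (Rle_dec x1 x2) as [H|H].
- pose proof (Hord x1 x2 (-1) ltac:(lra) ltac:(lra) ltac:(lra) ltac:(ring)); lra.
- pose proof (Hord x2 x1 1 ltac:(lra) ltac:(lra) ltac:(lra) ltac:(ring)) as H3.
  rewrite <- (opp_RInt_swap e x2 x1) by now apply ex_RInt_cont.
  unfold opp; simpl; lra.
Qed.

(** Substitute [t = tau + sin p]: one [cos p] comes out of the root, the other is the Jacobian. *)
Lemma phase_integral_subst tau d :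
  phase_integral tau d
  = RInt (fun t => sqrt ((1 - (t - tau) ^ 2) * ((t + tau) ^ 2 + d ^ 2)))
      (tau - 1) (tau + 1).
Proof.
set (g := fun t => sqrt ((1 - (t - tau) ^ 2) * ((t + tau) ^ 2 + d ^ 2))).
pose proof (RInt_comp g (fun p => tau + sin p) cos (- (PI / 2)) (PI / 2)) as H.
cbn beta in H; rewrite sin_neg, sin_PI2 in H.
replace (tau + - (1)) with (tau - 1) in H by ring.
unfold phase_integral, semicircle_int; rewrite <- H.
- apply RInt_ext; intros p Hp.
  pose proof PI_RGT_0.
  rewrite Rmin_left, Rmax_right in Hp by lra.
  assert (Hc : 0 <= cos p) by (apply cos_ge_0; lra).
  unfold g.
  pose proof (sin2_cos2 p) as E; unfold Rsqr in E.
  replace (1 - (tau + sin p - tau) ^ 2) with (cos p ^ 2) by nra.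
  rewrite sqrt_mult by (try apply Rplus_le_le_0_compat; apply pow2_ge_0).
  rewrite sqrt_pow2 by exact Hc.
  replace (tau + sin p + tau) with (sin p + 2 * tau) by ring.
  unfold scal; simpl; unfold mult; simpl; ring.
- intros p _; apply continuous_sqrt_comp.
  apply (ex_derive_continuous
    (fun t => (1 - (t - tau) ^ 2) * ((t + tau) ^ 2 + d ^ 2))); auto_derive; easy.
- intros p _; split; [auto_derive; [easy|ring]|apply continuous_cos].
Qed.

Lemma RInt_abs_around_0 a b :
  a <= 0 <= b -> RInt Rabs a b = (a ^ 2 + b ^ 2) / 2.
Proof.
intros H.
rewrite <- (RInt_Chasles Rabs a 0 b)
  by (apply ex_RInt_cont; intros; apply continuous_Rabs).
rewrite (RInt_ext Rabs (fun t => - t) a 0).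
- rewrite (RInt_ext Rabs (fun t => t) 0 b).
  + rewrite (RInt_antiderivative (fun t => - t ^ 2 / 2)).
    * rewrite (RInt_antiderivative (fun t => t ^ 2 / 2)).
      -- unfold plus; simpl; field.
      -- intros x; auto_derive; [easy|field].
      -- intros x; apply continuous_id.
    * intros x; auto_derive; [easy|field].
    * intros x; apply (ex_derive_continuous (fun t => - t)); auto_derive; easy.
  + intros x Hx; rewrite Rmin_left in Hx by lra; apply Rabs_right; lra.
- intros x Hx; rewrite Rmax_right in Hx by lra; apply Rabs_left1; lra.
Qed.

(** Let [b ^ 2] be the mean of [U ^ 2]. Large [b] is handled by calibration with a good shape, small
    [b] by [|U| <= 1 + |tau|] and calibration with [k ^ 2 t ^ 2]. *)
Lemma normalized_inequality L tau (U U' : R -> R) x1 x2 :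
  0 < L -> (forall x, is_derive U x (U' x)) -> (forall x, continuous U' x) ->
  (forall x, 0 <= x <= L -> tau - 1 <= U x <= tau + 1) ->
  0 <= x1 <= L -> 0 <= x2 <= L -> U x1 = tau - 1 -> U x2 = tau + 1 ->
  RInt U 0 L = 0 ->
  RInt (fun x => U x ^ 4) 0 L
  <= C0 * L * RInt (fun x => U x ^ 2) 0 L * RInt (fun x => U' x ^ 2) 0 L.
Proof.
intros HL HU HU' Hran Hx1 Hx2 E1 E2 Hmean.
assert (HUc : forall x, continuous U x)
  by (intros x; apply (is_derive_continuous U x (U' x)), HU).
assert (Hpow : forall (f : R -> R) n, (forall x, continuous f x) ->
  forall x, continuous (fun x => f x ^ n) x).
{ intros f n Hf x; apply (continuous_comp f (fun y => y ^ n)); [apply Hf|].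
  apply (ex_derive_continuous (fun y => y ^ n)); auto_derive; easy. }
set (A := RInt (fun x => U x ^ 2) 0 L).
set (B := RInt (fun x => U' x ^ 2) 0 L).
set (Q := RInt (fun x => U x ^ 4) 0 L).
assert (Hcst : forall a x : R, continuous (fun _ : R => a) x)
  by (intros; apply continuous_const).
assert (Hint1 : RInt (fun _ => 1) 0 L = L)
  by (rewrite RInt_const; unfold scal; simpl; unfold mult; simpl; ring).
assert (Hlow : forall a b, RInt (fun x => a * U x + b * 1) 0 L = b * L).
{ intros a b; rewrite (RInt_lin U (fun _ => 1)) by auto.
  rewrite Hmean, Hint1, Rmult_0_r, Rplus_0_l; reflexivity. }
assert (Hmid : forall k a b,
  RInt (fun x => k * U x ^ 2 + 1 * (a * U x + b * 1)) 0 L = k * A + b * L).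
{ intros k a b.
  rewrite (RInt_lin (fun x => U x ^ 2) (fun x => a * U x + b * 1)).
  - rewrite Hlow, Rmult_1_l; reflexivity.
  - apply Hpow, HUc.
  - intros x; apply @continuous_plus; [|apply Hcst].
    apply @continuous_scal_r, HUc. }
assert (Hmidc : forall k a b x,
  continuous (fun x => k * U x ^ 2 + 1 * (a * U x + b * 1)) x).
{ intros k a b x; apply @continuous_plus; apply @continuous_scal_r.
  - apply Hpow, HUc.
  - apply @continuous_plus; [apply @continuous_scal_r, HUc|apply Hcst]. }
assert (HA : 0 <= A).
{ apply RInt_ge_0; [lra| |intros; apply pow2_ge_0].
  apply ex_RInt_cont, Hpow, HUc. }
assert (HB : 0 <= B).
{ apply RInt_ge_0; [lra| |intros; apply pow2_ge_0].
  apply ex_RInt_cont, Hpow, HU'. }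
(* Integrate [(U - tau + 1) (tau + 1 - U) >= 0], using the zero mean. *)
assert (HAtau : A <= (1 - tau ^ 2) * L).
{ pose proof (Hmid (-1) (2 * tau) (1 - tau ^ 2)) as H.
  enough (0 <= RInt (fun x => -1 * U x ^ 2
    + 1 * (2 * tau * U x + (1 - tau ^ 2) * 1)) 0 L) by lra.
  apply RInt_ge_0; [lra|apply ex_RInt_cont, Hmidc|].
  intros x Hx; pose proof (Hran x ltac:(lra)); nra. }
assert (Htau2 : tau ^ 2 <= 1) by (apply (Rmult_le_reg_r L); lra).
assert (Htau : -1 <= tau <= 1) by (split; nra).
set (b := sqrt (A / L)).
assert (Hb : 0 <= b) by apply sqrt_pos.
assert (Hb2 : b ^ 2 * L = A).
{ unfold b; rewrite pow2_sqrt; [field; lra|].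
  apply Rmult_le_pos; [lra|apply Rlt_le, Rinv_0_lt_compat; lra]. }
assert (HC : 0 < C0) by (unfold C0; lra).
destruct (Rle_dec (0.2014 * (1 + Rabs tau)) b) as [Hbig|Hsmall].
- destruct (exists_good_shape tau b Hbig) as [d [Hd Hshape]]; [nra|].
  set (P := fun t => (1 - (t - tau) ^ 2) * ((t + tau) ^ 2 + d ^ 2)).
  assert (HP : forall t, continuous P t)
    by (intros t; apply (ex_derive_continuous P); unfold P; auto_derive; easy).
  pose proof (calibration L U U' P (fun t => sqrt (P t)) (C0 * L * A) x1 x2
    HU HU' ltac:(repeat apply Rmult_le_pos; lra) HP
    (fun t => continuous_sqrt_comp P t (HP t))) as H.
  rewrite E1, E2 in H.
  replace (RInt _ (tau - 1) (tau + 1)) with (phase_integral tau d) in H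
    by apply phase_integral_subst.
  assert (Hsq : sqrt (C0 * L * A) = sqrt C0 * (L * b)).
  { rewrite <- Hb2.
    replace (C0 * L * (b ^ 2 * L)) with (C0 * (L * b) ^ 2) by ring.
    rewrite sqrt_mult, sqrt_pow2; nra. }
  rewrite Hsq in H.
  (* The expanded quartic has no cubic term, and its linear term integrates to zero. *)
  rewrite (RInt_ext _ (fun x => C0 * L * A * U' x ^ 2 + 1 * (-1 * U x ^ 4 + 1 *
    ((1 + 2 * tau ^ 2 - d ^ 2) * U x ^ 2 + 1 * (2 * tau * (1 + d ^ 2) * U x
     + (1 - tau ^ 2) * (tau ^ 2 + d ^ 2) * 1))))) in H
    by (intros; real_eq; unfold P; ring).
  rewrite (RInt_lin (fun x => U' x ^ 2)) in H.
  + rewrite (RInt_lin (fun x => U x ^ 4)), Hmid in H.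
    * fold B Q in H.
      apply (Rmult_le_compat_l L) in Hshape; [|lra].
      assert (HPU : forall x, 0 <= x <= L -> sqrt (P (U x)) ^ 2 <= P (U x)).
      { intros x Hx; right; apply pow2_sqrt.
        pose proof (Hran x Hx).
        apply Rmult_le_pos; [nra|].
        apply Rplus_le_le_0_compat; apply pow2_ge_0. }
      specialize (H HPU Hx1 Hx2).
      rewrite <- Hb2 in H |- *; lra.
    * apply Hpow, HUc.
    * apply Hmidc.
  + apply Hpow, HU'.
  + intros x; apply @continuous_plus; apply @continuous_scal_r;
      [apply Hpow, HUc|apply Hmidc].
- apply Rnot_le_lt in Hsmall.
  set (N := 1 + Rabs tau) in *.
  assert (HN : 1 <= N) by (pose proof (Rabs_pos tau); unfold N; lra).
  assert (HNtau : N ^ 2 <= 2 * (1 + tau ^ 2)).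
  { unfold N; rewrite <- (pow2_abs tau); pose proof (pow2_ge_0 (1 - Rabs tau)).
    lra. }
  assert (HQ : Q <= N ^ 2 * A).
  { pose proof (RInt_lin (fun x => U x ^ 2) (fun _ => 1) (N ^ 2) 0 0 L
      (Hpow U 2%nat HUc) (Hcst 1)) as E.
    fold A in E; rewrite Hint1 in E.
    replace (N ^ 2 * A) with (N ^ 2 * A + 0 * L) by ring.
    rewrite <- E; apply RInt_le; [lra|apply ex_RInt_cont, Hpow, HUc| |].
    - apply ex_RInt_cont; intros x; apply @continuous_plus;
        apply @continuous_scal_r; [apply Hpow, HUc|apply Hcst].
    - intros x Hx; pose proof (Hran x ltac:(lra)) as Hx'.
      assert (HUN : U x ^ 2 <= N ^ 2).
      { apply pow_maj_Rabs; unfold N; apply Rabs_le.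
        pose proof (Rle_abs tau); pose proof (Rle_abs (- tau)) as Hn.
        rewrite Rabs_Ropp in Hn; lra. }
      pose proof (pow2_ge_0 (U x)); nra. }
  destruct (Req_dec A 0) as [HA0|HA0].
  { rewrite HA0 in HQ |- *; lra. }
  assert (Hab : (1 + tau ^ 2) ^ 2 <= A * B).
  (* This [k] maximises the lower bound [2 k (1 + tau ^ 2) - k ^ 2 A] for [B]. *)
  { set (k := (1 + tau ^ 2) / A).
    assert (Hk : 0 <= k).
    { apply Rmult_le_pos; [pose proof (pow2_ge_0 tau); lra|].
      apply Rlt_le, Rinv_0_lt_compat; lra. }
    assert (H : 2 * sqrt 1 * RInt (fun t => k * Rabs t) (U x1) (U x2)
      <= RInt (fun x => 1 * U' x ^ 2 + k ^ 2 * U x ^ 2) 0 L).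
    { apply (calibration L U U' (fun t => k ^ 2 * t ^ 2)); auto; [lra| | |].
      - intros t; apply (ex_derive_continuous (fun t => k ^ 2 * t ^ 2));
          auto_derive; easy.
      - intros t; apply (continuous_scal_r k Rabs), continuous_Rabs.
      - intros x _; right; rewrite Rpow_mult_distr, pow2_abs; ring. }
    rewrite E1, E2, sqrt_1 in H.
    rewrite (RInt_lin (fun x => U' x ^ 2) (fun x => U x ^ 2)) in H
      by (apply Hpow; assumption).
    rewrite (RInt_ext _ (fun t => scal k (Rabs t))) in H by reflexivity.
    rewrite (RInt_scal (V := R_CompleteNormedModule)), RInt_abs_around_0 in H;
      [|lra|apply ex_RInt_cont, continuous_Rabs].
    change (2 * 1 * (k * (((tau - 1) ^ 2 + (tau + 1) ^ 2) / 2))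
      <= 1 * B + k ^ 2 * A) in H.
    assert (HkA : k * A = 1 + tau ^ 2) by (unfold k; field; exact HA0).
    assert (H' : k * (1 + tau ^ 2) <= B).
    { replace (k ^ 2 * A) with (k * (k * A)) in H by ring.
      rewrite HkA in H; lra. }
    apply (Rmult_le_compat_l A) in H'; [|exact HA].
    replace (A * (k * (1 + tau ^ 2))) with (k * A * (1 + tau ^ 2)) in H' by ring.
    rewrite HkA in H'; lra. }
  eapply Rle_trans; [exact HQ|].
  replace (C0 * L * A * B) with (C0 * L * B * A) by ring.
  apply Rmult_le_compat_r; [exact HA|].
  assert (HLB : 0 <= L * B) by (apply Rmult_le_pos; lra).
  assert (HbN : b ^ 2 <= (0.2014 * N) ^ 2) by (apply pow_incr; lra).
  assert (HN4 : (N ^ 2) ^ 2 <= 4 * (1 + tau ^ 2) ^ 2).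
  { replace (4 * (1 + tau ^ 2) ^ 2) with ((2 * (1 + tau ^ 2)) ^ 2) by ring.
    apply pow_incr; split; [apply pow2_ge_0|exact HNtau]. }
  apply (Rmult_le_compat_r (L * B)) in HbN; [|exact HLB].
  replace (A * B) with (b ^ 2 * (L * B)) in Hab by (rewrite <- Hb2; ring).
  assert (HNpos : 0 < N ^ 2) by nra.
  apply (Rmult_le_reg_l (N ^ 2)); [exact HNpos|].
  (* The threshold 0.2014 makes [4 * 0.2014 ^ 2 = 0.16224784], just below [C0]. *)
  apply Rle_trans with (4 * 0.2014 ^ 2 * (N ^ 2 * (L * B))); [lra|].
  replace (N ^ 2 * (C0 * L * B)) with (C0 * (N ^ 2 * (L * B))) by ring.
  apply Rmult_le_compat_r; [apply Rmult_le_pos; lra|unfold C0; lra].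
Qed.

(** * Extension of functions from the interval *)

(** Nearest-point projection onto [[0, L]]; composing with it extends continuous functions to the
    line. *)
Definition clamp (L x : R) : R := Rmax 0 (Rmin x L).

Lemma clamp_range L x : 0 < L -> 0 <= clamp L x <= L.
Proof.
intros HL; unfold clamp, Rmax, Rmin.
repeat destruct (Rle_dec _ _); lra.
Qed.

Lemma clamp_id L x : 0 <= x <= L -> clamp L x = x.
Proof. intros Hx; unfold clamp; rewrite Rmin_left, Rmax_right; lra. Qed.

Lemma clamp_lipschitz L x y : Rabs (clamp L y - clamp L x) <= Rabs (y - x).
Proof.
unfold clamp, Rmax, Rmin.
repeat destruct (Rle_dec _ _);
  apply Rabs_le; pose proof (Rle_abs (y - x)) as H1;
  pose proof (Rle_abs (- (y - x))) as H2; rewrite Rabs_Ropp in H2; lra.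
Qed.

Lemma continuous_clamp_comp L (f : R -> R) :
  0 < L -> continuous_on (fun x => 0 <= x <= L) f ->
  forall x, continuous (fun y => f (clamp L y)) x.
Proof.
intros HL Hf x.
apply (filterlim_comp _ _ _ (clamp L) f _
  (within (fun y => 0 <= y <= L) (locally (clamp L x)))).
- intros Q [eps HQ]; exists eps; intros y Hy; apply HQ.
  + eapply Rle_lt_trans; [apply clamp_lipschitz|exact Hy].
  + now apply clamp_range.
- apply Hf, clamp_range, HL.
Qed.

Lemma is_derive_on_continuous a b f x l :
  is_derive_on a b f x l ->
  filterlim f (within (fun y => a <= y <= b) (locally x)) (locally (f x)).
Proof.
intros H; apply (filterdiff_continuous_aux (V := R_NormedModule)).
- eexists; exact H.
- intros Q HQ; unfold within; generalize HQ; apply filter_imp; auto.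
Qed.

(** The interval is itself a neighbourhood of an interior point, so restricting the filter changes
    nothing there. *)
Lemma is_derive_on_interior a b f x l :
  a < x < b -> is_derive_on a b f x l -> is_derive f x l.
Proof.
intros Hx [Hl Hd]; split; [exact Hl|].
intros z Hz.
assert (Hzx : x = z) by now apply is_filter_lim_locally_unique.
subst z.
specialize (Hd x).
assert (Hw : forall Q, within (fun y => a <= y <= b) (locally x) Q -> locally x Q).
{ intros Q HQ.
  assert (HI : locally x (fun y => a <= y <= b)).
  { apply (locally_interval _ x a b); simpl; [apply Hx|apply Hx|].
    intros y H1 H2; lra. }
  generalize (filter_and _ _ HI HQ); apply filter_imp.
  intros y [H1 H2]; now apply H2. }
intros eps; apply Hw; refine (Hd _ eps).
intros Q HQ; unfold within; generalize HQ; apply filter_imp; auto.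
Qed.

(** [U] integrates the clamped derivative from the value [u 0]; its difference from [u] has zero
    derivative inside the interval. *)
Lemma C1_extension L (u u' : R -> R) :
  0 < L -> is_C1_on 0 L u u' ->
  exists U U' : R -> R,
    (forall x, is_derive U x (U' x)) /\ (forall x, continuous U' x) /\
    (forall x, 0 <= x <= L -> U x = u x /\ U' x = u' x).
Proof.
intros HL [Hd Hc].
set (V := fun x => u' (clamp L x)).
assert (HV : forall x, continuous V x) by now apply continuous_clamp_comp.
set (U := fun x => u 0 + RInt V 0 x).
assert (HU : forall x, is_derive U x (V x)).
{ intros x; unfold U.
  replace (V x) with (plus 0 (V x)) by (unfold plus; simpl; ring).
  apply (is_derive_plus (fun _ => u 0) (fun x => RInt V 0 x));
    [exact (is_derive_const (K := R_AbsRing) (V := R_NormedModule) (u 0) x)|].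
  apply (is_derive_RInt V (fun x => RInt V 0 x) 0); [|apply HV].
  exists (mkposreal 1 Rlt_0_1); intros y _.
  apply (RInt_correct (V := R_CompleteNormedModule)), ex_RInt_cont, HV. }
exists U, V; split; [exact HU|split; [exact HV|]].
intros x Hx; split; [|unfold V; now rewrite clamp_id].
(* The mean value theorem asks for two-sided continuity at the ends, which [w] has. *)
set (w := fun x => u (clamp L x)).
assert (Hw : forall x, continuous w x).
{ apply continuous_clamp_comp; [exact HL|].
  intros y Hy; apply (is_derive_on_continuous _ _ _ _ (u' y)), Hd, Hy. }
destruct (MVT_gen (fun x => w x - U x) 0 x (fun _ => 0)) as [z [_ E]].
- intros y Hy; rewrite Rmin_left, Rmax_right in Hy by lra.
  replace 0 with (u' y - V y)
    by (unfold V; rewrite clamp_id by lra; ring).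
  apply (is_derive_minus w U); [|apply HU].
  apply (is_derive_ext_loc u).
  + apply (locally_interval _ y 0 x); simpl; [apply Hy|apply Hy|].
    intros t H1 H2; unfold w; rewrite clamp_id; lra.
  + apply (is_derive_on_interior 0 L); [lra|apply Hd; lra].
- intros y _; apply continuity_pt_minus; apply continuity_pt_filterlim.
  + apply Hw.
  + apply (is_derive_continuous U y (V y)), HU.
- unfold w in E; rewrite !clamp_id in E by lra.
  replace (U 0) with (u 0) in E
    by (unfold U; rewrite RInt_point; unfold zero; simpl; ring).
  lra.
Qed.

(** * Normalisation of the range and conclusion *)

Theorem theorem2 :
  forall (L : R) (u u' : R -> R),
    0 < L ->
    is_C1_on 0 L u u' ->
    u' 0 = 0 ->
    u' L = 0 ->
    RInt u 0 L = 0 ->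
    RInt (fun s => u s ^ 4) 0 L
      <= 0.162278 * L * RInt (fun s => u s ^ 2) 0 L
           * RInt (fun s => u' s ^ 2) 0 L.
Proof.
intros L u u' HL Hu _ _ Hmean.
destruct (C1_extension L u u' HL Hu) as [U [U' [HU [HU' HUu]]]].
assert (Hext : forall f : R -> R,
  RInt (fun s => f (u s)) 0 L = RInt (fun s => f (U s)) 0 L).
{ intros f; apply RInt_ext; intros x Hx.
  rewrite Rmin_left, Rmax_right in Hx by lra.
  destruct (HUu x ltac:(lra)) as [-> _]; reflexivity. }
assert (Hext' : forall f : R -> R,
  RInt (fun s => f (u' s)) 0 L = RInt (fun s => f (U' s)) 0 L).
{ intros f; apply RInt_ext; intros x Hx.
  rewrite Rmin_left, Rmax_right in Hx by lra.
  destruct (HUu x ltac:(lra)) as [_ ->]; reflexivity. }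
rewrite (Hext (fun y => y ^ 4)), (Hext (fun y => y ^ 2)), (Hext' (fun y => y ^ 2)).
change (RInt (fun s => (fun y => y) (u s)) 0 L = 0) in Hmean.
rewrite Hext in Hmean.
clear u u' Hu HUu Hext Hext'.
replace 0.162278 with C0 by (unfold C0; lra).
assert (HUc : forall x, continuous U x)
  by (intros x; apply (is_derive_continuous U x (U' x)), HU).
assert (Hpt : forall x, 0 <= x <= L -> continuity_pt U x)
  by (intros; apply continuity_pt_filterlim, HUc).
destruct (continuity_ab_maj U 0 L ltac:(lra) Hpt) as [x2 [Hmax Hx2]].
destruct (continuity_ab_min U 0 L ltac:(lra) Hpt) as [x1 [Hmin Hx1]].
(* If the maximum does not exceed the minimum, [U] is constant, hence zero by its mean. *)
destruct (Rle_dec (U x2) (U x1)) as [Hconst|Hlt].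
- assert (Hc : forall f : R -> R, RInt (fun s => f (U s)) 0 L = L * f (U x1)).
  { intros f; rewrite (RInt_ext _ (fun _ => f (U x1))).
    - rewrite RInt_const; unfold scal; simpl; unfold mult; simpl; ring.
    - intros x Hx; rewrite Rmin_left, Rmax_right in Hx by lra.
      f_equal; pose proof (Hmax x ltac:(lra)); pose proof (Hmin x ltac:(lra)); lra. }
  change (RInt (fun s => (fun y => y) (U s)) 0 L = 0) in Hmean.
  rewrite Hc in Hmean.
  rewrite (Hc (fun y => y ^ 4)), (Hc (fun y => y ^ 2)).
  replace (U x1) with 0 by nra.
  right; ring.
- apply Rnot_le_lt in Hlt.
  (* Dividing by half the oscillation gives a range of length 2 centred at [tau]; both sides are
     homogeneous of degree 4. *)
  set (rho := (U x2 - U x1) / 2).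
  assert (Hrho : 0 < rho) by (unfold rho; lra).
  assert (Hscale : forall (f : R -> R) n, (forall x, continuous f x) ->
    RInt (fun x => (/ rho * f x) ^ n) 0 L = / rho ^ n * RInt (fun x => f x ^ n) 0 L).
  { intros f n Hf.
    rewrite (RInt_ext _ (fun x => scal (/ rho ^ n) (f x ^ n)))
      by (intros; unfold scal; simpl; unfold mult; simpl;
          now rewrite Rpow_mult_distr, pow_inv).
    rewrite (RInt_scal (V := R_CompleteNormedModule)); [reflexivity|].
    apply ex_RInt_cont; intros x.
    apply (continuous_comp f (fun y => y ^ n)); [apply Hf|].
    apply (ex_derive_continuous (fun y => y ^ n)); auto_derive; easy. }
  set (tau := (U x1 + U x2) / (2 * rho)).
  assert (Htau : / rho * U x1 = tau - 1 /\ / rho * U x2 = tau + 1).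
  { assert (U x2 - U x1 <> 0) by lra.
    unfold tau, rho; split; field; lra. }
  assert (H : RInt (fun x => (/ rho * U x) ^ 4) 0 L
    <= C0 * L * RInt (fun x => (/ rho * U x) ^ 2) 0 L
       * RInt (fun x => (/ rho * U' x) ^ 2) 0 L).
  { apply (normalized_inequality L tau _ _ x1 x2); try tauto.
    - intros x; apply is_derive_scal, HU.
    - intros x; apply @continuous_scal_r, HU'.
    - intros x Hx; pose proof (Hmin x Hx); pose proof (Hmax x Hx).
      pose proof (Rinv_0_lt_compat rho Hrho).
      destruct Htau as [<- <-]; split; apply Rmult_le_compat_l; lra.
    - rewrite (RInt_ext _ (fun x => scal (/ rho) (U x))) by reflexivity.
      rewrite (RInt_scal (V := R_CompleteNormedModule)) by now apply ex_RInt_cont.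
      change (RInt U 0 L = 0) in Hmean; rewrite Hmean.
      apply (Rmult_0_r (/ rho)). }
  rewrite !Hscale in H by assumption.
  apply (Rmult_le_reg_l (/ rho ^ 4)); [apply Rinv_0_lt_compat, pow_lt, Hrho|].
  eapply Rle_trans; [exact H|right].
  set (a := RInt _ 0 L); set (b := RInt _ 0 L); real_eq; field; lra.
Qed.
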